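(* Let $p$ be a fixed prime. For every $\epsilon > 0$ there exists a $\delta = \delta(\epsilon) > 0$ (not depending on $n$ or $A$) such that for every $n$ and every subset $A \subseteq \mathbb{F}_p^n$, at least one of the following holds: (i) $|A| \leq \epsilon |\mathbb{F}_p^n|$; (ii) $|(A+A) \cap A^c| > \delta |\mathbb{F}_p^n|$; (iii) there is a subspace $H \leqslant \mathbb{F}_p^n$ such that $|A \Delta H| \leq \epsilon |\mathbb{F}_p^n|$.
   Context: Here $A + A = \{a + b : a, b \in A\}$, $A^c$ is the complement of $A$ in $\mathbb{F}_p^n$, and $A \Delta H$ is the symmetric difference of $A$ and $H$. *)

(* Defs.v *)
From mathcomp Require Import all_boot all_order all_algebra.
From mathcomp Require Import reals.

Set Implicit Arguments.
Unset Strict Implicit.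
Unset Printing Implicit Defensive.

Import Order.TTheory GRing.Theory Num.Theory.
Local Open Scope ring_scope.

Definition sumset (V : finZmodType) (A B : {set V}) : {set V} :=
  [set a + b | a in A, b in B].

Definition symdiff (T : finType) (A B : {set T}) : {set T} :=
  (A :\: B) :|: (B :\: A).

(* Main.v *)
(** If [A] has density more than [epsilon] and [A + A] exceeds [A] by at most
    [epsilon / 2], then [|A + A| < 3/2 |A|].  Two translates of [A] by elements
    of [A] then overlap in more than half of [A], so every element of [A - A]
    has more than [|A| / 2] representations as a difference.  By pigeonhole
    [A - A] is a subgroup, and by counting representations it has fewer than
    [2 |A|] elements.  Since [A + A] meets [A], the set [A] lies in [A - A],
    and pigeonhole again gives [A + A = A - A]. *)

Require Import Defs.
From mathcomp Require Import all_boot all_order all_algebra.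
From mathcomp Require Import reals.
From mathcomp Require Import zify lra.

Set Implicit Arguments.
Unset Strict Implicit.
Unset Printing Implicit Defensive.

Import Order.TTheory GRing.Theory Num.Theory.
Local Open Scope ring_scope.

Section SmallDoubling.

Variables (V : finZmodType) (A : {set V}).

Definition diffset : {set V} := [set a - b | a in A, b in A].

Definition diffreps (d : V) : {set V} := [set c in A | c - d \in A].

Lemma mem_diffset a b : a \in A -> b \in A -> a - b \in diffset.
Proof. by move=> aA bA; apply/imset2P; exists a b. Qed.

Lemma mem_sumset a b : a \in A -> b \in A -> a + b \in sumset A A.
Proof. by move=> aA bA; apply/imset2P; exists a b. Qed.

Lemma pigeonhole (T : finType) (B C D : {set T}) :
  B \subset D -> C \subset D -> (#|D| < #|B| + #|C|)%N ->
  exists2 x, x \in B & x \in C.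
Proof.
move=> BD CD; rewrite -cardsUI => ltD.
have /card_gt0P[x /setIP[xB xC]] : (0 < #|B :&: C|)%N; last by exists x.
have : (#|B :|: C| <= #|D|)%N by rewrite subset_leq_card // subUset BD.
lia.
Qed.

Hypothesis small_doubling : (2 * #|sumset A A| < 3 * #|A|)%N.

Lemma card_diffreps d : d \in diffset -> (#|A| < 2 * #|diffreps d|)%N.
Proof.
case/imset2P=> a b aA bA ->.
pose Aa := [set c + a | c in A]; pose Ab := [set c + b | c in A].
have cardT x : #|[set c + x | c in A]| = #|A| by rewrite card_imset //; exact: addIr.
have UA : (#|Aa :|: Ab| <= #|sumset A A|)%N.
  apply: subset_leq_card; rewrite subUset.
  by apply/andP; split; apply/subsetP=> _ /imsetP[c cA ->]; exact: mem_sumset.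
(* A common point [c + a = c' + b] gives [c' - (a - b) = c], so shifting the overlap back by [b]
   lands in the representations of [a - b]. *)
have IA : (#|Aa :&: Ab| <= #|diffreps (a - b)%R|)%N.
  rewrite -(card_imset _ (addIr b)); apply: subset_leq_card.
  apply/subsetP=> _ /setIP[/imsetP[c cA ->] /imsetP[c' c'A e]].
  apply/imsetP; exists c' => //; rewrite inE c'A /=.
  by rewrite opprB addrA -e addrK.
have := cardsUI Aa Ab; rewrite !cardT.
move: small_doubling UA IA; lia.
Qed.

Lemma diffset_subgroup x y : x \in diffset -> y \in diffset -> x - y \in diffset.
Proof.
move=> xD yD.
have sub d : diffreps d \subset A by apply/subsetP=> c /setIdP[].
(* A common [c] yields [x - y = (c - y) - (c - x)], a difference of two elements of [A]. *)
have [|c] := pigeonhole (sub x) (sub y).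
  by have := card_diffreps xD; have := card_diffreps yD; lia.
rewrite !inE => /andP[_ cx] /andP[_ cy].
by have := mem_diffset cy cx; rewrite opprB addrC addrA subrK.
Qed.

(** Double counting of pairs [(d, c)] with [c] and [c - d] in [A]: each [d] in [diffset] has more
    than [|A| / 2] partners, each [c] at most [|A|]. *)
Lemma card_diffset : (#|diffset| < 2 * #|A|)%N.
Proof.
have A0 : (0 < #|A|)%N by move: small_doubling; lia.
have lower : (#|diffset| * #|A|.+1 <= \sum_(d in diffset) 2 * #|diffreps d|)%N.
  by rewrite -sum_nat_const; apply: leq_sum => d; exact: card_diffreps.
have upper : (\sum_(d in diffset) #|diffreps d| <= #|A| * #|A|)%N.
  under eq_bigr => d _ do rewrite -sum1dep_card big_mkcondr /=.
  rewrite exchange_big /= -sum_nat_const; apply: leq_sum => c cA.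
  rewrite -big_mkcondr /= sum1dep_card.
  rewrite -[X in (_ <= X)%N](card_imset _ (subrI c)).
  apply: subset_leq_card; apply/subsetP=> d; rewrite inE => /andP[_ cdA].
  by apply/imsetP; exists (c - d); rewrite ?subKr.
rewrite -(ltn_pmul2r (ltn0Sn #|A|)) (leq_ltn_trans lower) // -big_distrr /=.
by rewrite -mulnA ltn_pmul2l // (leq_ltn_trans upper) // ltn_pmul2l.
Qed.

Lemma sumset_eq_diffset (a b : V) :
  a \in A -> b \in A -> a + b \in A -> A \subset diffset /\ sumset A A = diffset.
Proof.
move=> aA bA abA.
have D0 : 0 \in diffset by rewrite -(subrr a) mem_diffset.
have DN x : x \in diffset -> - x \in diffset.
  by move=> xD; rewrite -sub0r diffset_subgroup.
have DD x y : x \in diffset -> y \in diffset -> x + y \in diffset.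
  by move=> xD yD; rewrite -[y]opprK diffset_subgroup // DN.
(* Write [c = (c - a) + a] with [a = (a + b) - b]. *)
have AD : A \subset diffset.
  apply/subsetP=> c cA; rewrite -(subrK a c) DD ?mem_diffset //.
  by rewrite -(addrK b a) mem_diffset.
split=> //; apply/eqP; rewrite eqEsubset; apply/andP; split.
  by apply/subsetP=> _ /imset2P[x y xA yA ->]; rewrite DD // (subsetP AD).
apply/subsetP=> h hD.
(* [A] and its reflection [h - A] are both too large to be disjoint inside [diffset]; a common point
   [x = h - c] gives [h = x + c]. *)
have ND : [set h - c | c in A] \subset diffset.
  by apply/subsetP=> _ /imsetP[c cA ->]; rewrite diffset_subgroup // (subsetP AD).
have [|x xA /imsetP[c cA xE]] := pigeonhole AD ND.
  by rewrite card_imset ?addnn -?mul2n ?card_diffset //; exact: subrI.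
by rewrite -(subrK c h) -xE mem_sumset.
Qed.

End SmallDoubling.

(** Since [|A + A| >= |A|], an excess below [|A| / 2] also forces [A + A] to meet [A]. Then [A] lies
    in [D = A + A], so the symmetric difference is exactly the excess. *)
Lemma almost_sum_closed_subgroup (V : finZmodType) (A : {set V}) :
  (2 * #|sumset A A :&: ~: A| < #|A|)%N ->
  exists D : {set V}, [/\ 0 \in D, {in D &, forall x y, x - y \in D} &
    symdiff A D = sumset A A :&: ~: A].
Proof.
move=> excess.
have cardS := cardsID A (sumset A A); rewrite setDE in cardS.
have capA : (#|sumset A A :&: A| <= #|A|)%N by rewrite subset_leq_card // subsetIr.
have doubling : (2 * #|sumset A A| < 3 * #|A|)%N by lia.
have [a aA] : exists a, a \in A by apply/card_gt0P; lia.
have leAS : (#|A| <= #|sumset A A|)%N.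
  rewrite -(card_imset _ (addrI a)); apply: subset_leq_card.
  by apply/subsetP=> _ /imsetP[c cA ->]; exact: mem_sumset.
have /card_gt0P[_ /setIP[/imset2P[b c bA cA ->] bcA]] :
  (0 < #|sumset A A :&: A|)%N by lia.
have [AD SD] := sumset_eq_diffset doubling bA cA bcA.
exists (diffset A); split; last 1 first.
- have AD0 : A :\: diffset A = set0 by apply/eqP; rewrite setD_eq0.
  by rewrite /symdiff AD0 set0U -SD setDE.
- by rewrite -(subrr a) mem_diffset.
- exact: diffset_subgroup.
Qed.

Lemma subgroup_vspace (p n : nat) (D : {set 'rV['F_p]_n}) :
  0 \in D -> {in D &, forall x y, x - y \in D} ->
  exists H : {vspace 'rV['F_p]_n}, [set x in H] = D.
Proof.
move=> D0 DB; exists <<enum D>>%VS.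
have DD : {in D &, forall x y, x + y \in D}.
  by move=> x y xD yD; rewrite -[y]opprK DB // -sub0r DB.
apply/setP=> x; rewrite inE; apply/idP/idP => [|xD]; last first.
  by rewrite memv_span // mem_enum.
rewrite -[enum D]/(tval (in_tuple (enum D))) => /coord_span ->.
elim/big_ind: _ => // i _.
have : (enum D)`_i \in D by rewrite -mem_enum mem_nth.
(* Scalars of a prime field are images of naturals, so scaling is repeated addition. *)
rewrite -[coord _ _ _]natr_Zp scaler_nat /=; move: (nat_of_ord (coord _ _ _)) (_`_i) => m u uD.
elim: m => [|k IHk]; first by rewrite mulr0n.
by rewrite mulrS DD.
Qed.

Theorem corollary1p7 (R : realType) (p : nat) (hp : prime p) (epsilon : R)
    (hepsilon : 0 < epsilon) :
  exists delta : R, 0 < delta /\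
    forall (n : nat) (A : {set 'rV['F_p]_n}),
      #|A|%:R <= epsilon * #|{: 'rV['F_p]_n}|%:R
      \/ #|sumset A A :&: ~: A|%:R > delta * #|{: 'rV['F_p]_n}|%:R
      \/ exists H : {vspace 'rV['F_p]_n},
           #|symdiff A [set x in H]|%:R <= epsilon * #|{: 'rV['F_p]_n}|%:R.
Proof.
(* With this choice, failure of (i) and (ii) makes twice the excess smaller than [|A|]. *)
exists (epsilon / 2); split; first by rewrite divr_gt0.
move=> n A; set N : R := #|{: 'rV['F_p]_n}|%:R.
have [|bigA] := leP #|A|%:R (epsilon * N); first by left.
right; have [smallS|] := leP #|sumset A A :&: ~: A|%:R (epsilon / 2 * N); last by left.
right.
have [|D [D0 DB symD]] := @almost_sum_closed_subgroup _ A.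
  by rewrite -(ltr_nat R) natrM; lra.
have [H HD] := subgroup_vspace D0 DB.
exists H; rewrite HD symD; apply: le_trans smallS _.
by rewrite ler_wpM2r // ler_pdivrMr // ler_peMr ?ler1n // ltW.
Qed.
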